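(* Let $a_1,a_2,a_3,b_1,b_2,c_1,c_2 \in \mathbb{R}$ and let $$A= \begin{pmatrix} a_1 & 0 & 0 \\ c_1 & a_2& 0 \\ 0 & c_2 & a_3 \end{pmatrix}, \quad B= \begin{pmatrix} 0 & 0 & b_1 \\ 0 & 0& b_2 \\ 0 & 0 & 0 \end{pmatrix}.$$ The pair $(A, B)$ is diagonally Riccati stable if and only if all of the following hold: (i) $a_i < 0$ for $1 \leq i \leq 3$; (ii) $a_2a_3 > |b_2c_2|$; (iii) $|a_1a_2a_3| > |c_2(b_1c_1 - a_1b_2)|$.
   Context: $M \succ 0$ ($M \prec 0$) means that the real matrix $M=M^T$ is positive definite (negative definite). A pair $(A,B)$ of matrices in $\mathbb{R}^{n\times n}$ is diagonally Riccati stable if there exist diagonal $P \succ 0$, $Q \succ 0$ in $\mathbb{R}^{n \times n}$ with $A^TP+PA + Q + PBQ^{-1}B^TP \prec 0$. *)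

(* Defs.v *)
From mathcomp Require Import all_boot all_order all_algebra.
From mathcomp Require Import reals.

Set Implicit Arguments.
Unset Strict Implicit.
Unset Printing Implicit Defensive.

Import Order.TTheory GRing.Theory Num.Theory.
Local Open Scope ring_scope.

Definition posdefmx (R : realType) (n : nat) (M : 'M[R]_n) : Prop :=
  M^T = M /\ forall x : 'cV[R]_n, x != 0 -> 0 < (x^T *m M *m x) 0 0.

Definition negdefmx (R : realType) (n : nat) (M : 'M[R]_n) : Prop :=
  M^T = M /\ forall x : 'cV[R]_n, x != 0 -> (x^T *m M *m x) 0 0 < 0.

Definition diag_Riccati_stable (R : realType) (n : nat) (A B : 'M[R]_n) : Prop :=
  exists P Q : 'M[R]_n,
    [/\ is_diag_mx P, posdefmx P, is_diag_mx Q, posdefmx Q &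
        negdefmx (A^T *m P + P *m A + Q
                  + P *m B *m invmx Q *m B^T *m P)].

(* Entries outside the given lists are 0. *)
Definition mx_of_rows (R : realType) (m n : nat) (s : seq (seq R)) :
    'M[R]_(m, n) :=
  \matrix_(i < m, j < n) nth 0 (nth [::] s i) j.

(* Main.v *)
Require Import Defs.
From mathcomp Require Import all_boot all_order all_algebra.
From mathcomp Require Import reals.
From mathcomp Require Import ring lra.

Import Order.TTheory GRing.Theory Num.Theory.
Local Open Scope ring_scope.

(** Write f(x) for the quadratic form of the Riccati matrix.  With the
    diagonal entries p_i of P and q_j of Q it is
      f(x) = 2 x^T P A x + sum_j (q_j x_j^2 + r_j^2 / q_j),   r = B^T P x.

    Necessity.  By the arithmetic-geometric inequality
    q_j x_j^2 + r_j^2 / q_j >= 2 s x_j r_j for s = 1 and s = -1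
    ([riccati_form_ge]), so P makes both A + B and A - B diagonally stable:
    x^T P (A + s B) x < 0 for all nonzero x.  A matrix N with this property
    has principal minors of the sign of (-1)^(their order).  For N = A + s B
    this says that the a_i are negative, a2 a3 - s b2 c2 > 0 and
    det N = a1 a2 a3 + s c2 (b1 c1 - a1 b2) < 0; over both signs s these are
    the three conditions.

    Sufficiency.  Let (u, v, w) be the argument of f; from here on x = 1 / p1.
    Put q3 = 1, g = c2 / a3, and first q1 = q2 = 0.  The best p3 is - 1 / a3;
    then w occurs in f only in the square - (w + g v)^2, and what remains is a
    form in u and v.  Once v is replaced by v / p2, its coefficient of v^2 is a
    quadratic polynomial in 1 / p2 with minimum b2^2 - k^2 at p2 = - a2 / k^2,
    where k = |a2 a3 / c2| ([exists_gain_bound] supplies a k that also works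
    when c2 = 0).  With this p2, up to the positive factor (p1 p2)^2 the remaining form is negative
    definite as soon as
      (c1 x + b1 b2)^2 < (- 2 a1 x - b1^2) (k^2 - b2^2),
    that is b1^2 k^2 + c1^2 x^2 < 2 x d
    with d = - a1 (k^2 - b2^2) - c1 b1 b2.  Some x > 0 does this as soon as
    |b1 c1| k < d ([exists_pos_scale]), and d - b1 c1 k and d + b1 c1 k factor
    into quantities that the hypotheses make positive ([weighted_margin]).
    All inequalities being strict, there is room for a small q1 = q2 = e > 0
    ([exists_shift_disc]). *)

Set Implicit Arguments.
Unset Strict Implicit.
Unset Printing Implicit Defensive.

(** * The Riccati condition as an inequality between quadratic forms *)

Lemma diag_formE (R : realType) n (d : 'rV[R]_n) (y z : 'cV[R]_n) :
  (y^T *m diag_mx d *m z) 0 0 = \sum_i d 0 i * y i 0 * z i 0.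
Proof.
rewrite mxE; apply: eq_bigr => i _.
by rewrite mul_mx_diag !mxE (mulrC (y i 0)).
Qed.

Lemma posdef_diagP (R : realType) n (d : 'rV[R]_n) :
  posdefmx (diag_mx d) <-> forall i, 0 < d 0 i.
Proof.
split=> [[_ dpos] i | dpos].
  have := dpos (delta_mx i 0); rewrite diag_formE (bigD1 i) //= big1 => [|j /negPf ji].
    rewrite !mxE !eqxx !mulr1 addr0; apply.
    by apply/eqP => /matrixP/(_ i 0)/eqP; rewrite !mxE !eqxx oner_eq0.
  by rewrite !mxE ji mulr0.
split=> [|x /cV0Pn [i xi0]]; first exact: tr_diag_mx.
rewrite diag_formE (bigD1 i) //= ltr_wpDr //.
  by apply: sumr_ge0 => j _; rewrite -mulrA mulr_ge0 // -?expr2 ?sqr_ge0 // ltW.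
by rewrite -mulrA mulr_gt0 // -expr2 exprn_even_gt0.
Qed.

Lemma invmx_diag (R : fieldType) n (d : 'rV[R]_n) :
  (forall i, d 0 i != 0) -> invmx (diag_mx d) = diag_mx (\row_i (d 0 i)^-1).
Proof.
move=> d0; set E := diag_mx (\row_i _).
have dE : diag_mx d *m E = 1%:M.
  rewrite mulmx_diag -diag_const_mx; congr diag_mx.
  by apply/rowP => i; rewrite !mxE divff.
have [Ud _] := mulmx1_unit dE.
by rewrite -[LHS]mulmx1 -dE mulKmx.
Qed.

(** The inner sum of the last term is the [j]-th entry of B^T P x, with
    P = [diag_mx p]. *)
Definition riccati_form (R : realType) n (A B : 'M[R]_n) (p q : 'rV[R]_n)
    (x : 'cV[R]_n) : R :=
  (\sum_i p 0 i * x i 0 * (A *m x) i 0) *+ 2 + \sum_i q 0 i * x i 0 ^+ 2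
  + \sum_j (\sum_i p 0 i * x i 0 * B i j) ^+ 2 / q 0 j.

Lemma diag_Riccati_stableP (R : realType) n (A B : 'M[R]_n) :
  diag_Riccati_stable A B <->
  exists p q : 'rV[R]_n,
    [/\ forall i, 0 < p 0 i, forall i, 0 < q 0 i &
        forall x, x != 0 -> riccati_form A B p q x < 0].
Proof.
have formE (p q : 'rV[R]_n) x : (forall i, 0 < q 0 i) ->
    (x^T *m (A^T *m diag_mx p + diag_mx p *m A + diag_mx q
       + diag_mx p *m B *m invmx (diag_mx q) *m B^T *m diag_mx p) *m x) 0 0
    = riccati_form A B p q x.
  move=> q_gt0; rewrite invmx_diag => [|i]; last exact: lt0r_neq0.
  rewrite !mulmxDr !mulmxDl [LHS]mxE [X in X + _]mxE [X in X + _ + _]mxE.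
  rewrite /riccati_form mulr2n; congr (_ + _ + _ + _).
  - rewrite !mulmxA -trmx_mul diag_formE.
    by apply: eq_bigr => i _; rewrite mulrAC.
  - by rewrite mulmxA -mulmxA diag_formE.
  - by rewrite diag_formE; apply: eq_bigr => i _; rewrite expr2 mulrA.
  - pose r := B^T *m diag_mx p *m x.
    have rE j : r j 0 = \sum_i p 0 i * x i 0 * B i j.
      rewrite /r -mulmxA mxE; apply: eq_bigr => i _.
      by rewrite mul_diag_mx !mxE mulrC.
    transitivity ((r^T *m diag_mx (\row_i (q 0 i)^-1) *m r) 0 0).
      by rewrite /r !trmx_mul trmxK tr_diag_mx !mulmxA.
    rewrite diag_formE; apply: eq_bigr => j _.
    by rewrite rE !mxE -mulrA -expr2 mulrC.
split=> [[P [Q [/is_diag_mxP dP pP /is_diag_mxP dQ pQ [_ nM]]]] | [p [q [p0 q0 neg]]]].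
  have diagE (D : 'M[R]_n) : (forall i j : 'I_n, i != j :> nat -> D i j = 0) ->
      D = diag_mx (\row_i D i i).
    move=> dD; apply/matrixP => i j; rewrite !mxE.
    by case: eqVneq => [->|/dD].
  rewrite (diagE _ dP) in pP nM; rewrite (diagE _ dQ) in pQ nM.
  move/posdef_diagP: pP => p0; move/posdef_diagP: pQ => q0.
  by exists (\row_i P i i), (\row_i Q i i); split=> // x /nM; rewrite formE.
exists (diag_mx p), (diag_mx q); split.
- exact: diag_mx_is_diag.
- exact/posdef_diagP.
- exact: diag_mx_is_diag.
- exact/posdef_diagP.
split=> [|x /neg]; last by rewrite formE.
rewrite invmx_diag => [|i]; last exact: lt0r_neq0.
rewrite !linearD /= !trmx_mul !trmxK !tr_diag_mx !mulmxA.
by congr (_ + _ + _); rewrite addrC.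
Qed.

(** Completing the square in each coordinate: the difference of the two sides is
    the sum over j of (q_j s x_j - r_j)^2 / q_j.  This removes Q from the
    inequality, and leaves the quadratic form of P (A + s B). *)
Lemma riccati_form_ge (R : realType) n (A B : 'M[R]_n) (p q : 'rV[R]_n) s (x : 'cV[R]_n) :
  (forall i, 0 < q 0 i) -> s ^+ 2 = 1 ->
  (\sum_i p 0 i * x i 0 * ((A + s *: B) *m x) i 0) *+ 2 <= riccati_form A B p q x.
Proof.
move=> q_gt0 s2; rewrite /riccati_form.
set r := fun j => \sum_i p 0 i * x i 0 * B i j.
have -> : \sum_i p 0 i * x i 0 * ((A + s *: B) *m x) i 0
    = \sum_i p 0 i * x i 0 * (A *m x) i 0 + \sum_j s * x j 0 * r j.
  under eq_bigr => i _ do rewrite mulmxDl mxE mulrDr.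
  rewrite big_split /=; congr (_ + _).
  under [RHS]eq_bigr => j _ do rewrite mulr_sumr.
  rewrite exchange_big /=; apply: eq_bigr => i _.
  rewrite mxE mulr_sumr; apply: eq_bigr => j _; rewrite !mxE; ring.
rewrite mulrnDl -[leRHS]addrA lerD2l -big_split -sumrMnl ler_sum //= => j _.
have qj := q_gt0 j; rewrite -subr_ge0.
have -> : q 0 j * x j 0 ^+ 2 + r j ^+ 2 / q 0 j - (s * x j 0 * r j) *+ 2
    = (q 0 j * (s * x j 0) - r j) ^+ 2 / q 0 j.
  rewrite -[x j 0 ^+ 2]mul1r -s2; field; exact: lt0r_neq0.
by rewrite divr_ge0 ?sqr_ge0 // ltW.
Qed.

(** * Real inequalities for the choice of P and Q *)

Lemma neg_quad2 (R : realFieldType) (l n m u v : R) :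
  0 < l -> m ^+ 2 < l * n -> (u != 0) || (v != 0) ->
  - l * u ^+ 2 + (m * u * v) *+ 2 - n * v ^+ 2 < 0.
Proof.
move=> l0 disc uv.
rewrite -(pmulr_rlt0 _ l0).
have -> : l * (- l * u ^+ 2 + (m * u * v) *+ 2 - n * v ^+ 2)
   = - ((l * u - m * v) ^+ 2 + (l * n - m ^+ 2) * v ^+ 2) by ring.
rewrite oppr_lt0; have [v0|v0] := eqVneq v 0.
  rewrite v0 eqxx orbF in uv.
  rewrite v0 mulr0 subr0 expr0n mulr0 addr0 exprn_even_gt0 //=.
  by rewrite mulf_neq0 // lt0r_neq0.
by rewrite ltr_wpDl ?sqr_ge0 // mulr_gt0 ?subr_gt0 // exprn_even_gt0.
Qed.

(** Room for the matrix Q: a positive definite symmetric 2 x 2 matrix stays so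
    after subtracting a small multiple of the identity. *)
Lemma exists_shift_disc (R : realFieldType) (l n m : R) :
  0 < l -> m ^+ 2 < l * n ->
  exists2 e, 0 < e & e < l /\ m ^+ 2 < (l - e) * (n - e).
Proof.
move=> l0 disc.
have n0 : 0 < n by rewrite -(pmulr_rgt0 _ l0) (le_lt_trans (sqr_ge0 m)).
have ln0 : 0 < l + n by rewrite addr_gt0.
(* with this e, the determinant (l - e) (n - e) is exactly m^2 + e^2 *)
pose e := (l * n - m ^+ 2) / (l + n).
have e0 : 0 < e by rewrite divr_gt0 ?subr_gt0.
exists e => //; split.
  by rewrite ltr_pdivrMr //; have := mulr_gt0 l0 l0; have := sqr_ge0 m; lra.
have -> : (l - e) * (n - e) = m ^+ 2 + e ^+ 2.
  rewrite /e; field; exact: lt0r_neq0.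
by rewrite ltrDl exprn_gt0.
Qed.

(** For c != 0 the minimum of (b^2 + c^2 x^2) / x over x > 0 is 2 |b c|; for
    c = 0 its infimum 0 is approached for large x.  The witness d / c^2 is the
    minimiser of c^2 x^2 - 2 d x, which has the advantage of needing no case
    distinction on b. *)
Lemma exists_pos_scale (R : realFieldType) (b c d : R) :
  `|b * c| < d -> exists2 x, 0 < x & b ^+ 2 + c ^+ 2 * x ^+ 2 < (x * d) *+ 2.
Proof.
move=> bcd; have d0 : 0 < d := le_lt_trans (normr_ge0 _) bcd.
have [c0|c0] := eqVneq c 0.
  exists ((b ^+ 2 + 1) / d); first by rewrite divr_gt0 // ltr_wpDl ?sqr_ge0.
  rewrite c0 divfK ?lt0r_neq0 //; have := sqr_ge0 b; lra.
have c2 : 0 < c ^+ 2 by rewrite exprn_even_gt0.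
exists (d / c ^+ 2); first by rewrite divr_gt0.
rewrite -subr_gt0.
have -> : (d / c ^+ 2 * d) *+ 2 - (b ^+ 2 + c ^+ 2 * (d / c ^+ 2) ^+ 2)
   = (d ^+ 2 - `|b * c| ^+ 2) / c ^+ 2.
  by rewrite -normrX ger0_norm ?sqr_ge0 //; field.
by rewrite divr_gt0 // subr_gt0 ltr_pXn2r // ?nnegrE ?normr_ge0 ?ltW.
Qed.

(** When c != 0 the number k is g / |c|, and the two hypotheses are the two last
    conclusions.  The lemma makes the quotient available for c = 0, where any
    large k will do. *)
Lemma exists_gain_bound (R : realFieldType) (g c b t : R) :
  `|b * c| < g -> `|c * t| < g ->
  exists k, [/\ 0 < k, `|k * c| <= g, `|b| < k & `|t| < k].
Proof.
move=> bc tc; have [c0|c0] := eqVneq c 0.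
  exists (1 + `|b| + `|t|); have := normr_ge0 b; have := normr_ge0 t.
  move: tc; rewrite c0 mulr0 mul0r normr0 => g0 t0 b0; split; lra.
have nc : 0 < `|c| by rewrite normr_gt0.
have g0 : 0 < g := le_lt_trans (normr_ge0 _) bc.
exists (g / `|c|); split.
- by rewrite divr_gt0.
- by rewrite normrM ger0_norm ?divfK ?lt0r_neq0 // divr_ge0 // ltW.
- by rewrite ltr_pdivlMr // -normrM.
- by rewrite ltr_pdivlMr // mulrC -normrM.
Qed.

(** Let D be the right-hand side and s = b1 c1.  The two inequalities to prove
    come from the factorisations
      D + k s = (k - b2) (al k + (s + al b2)),
      D - k s = (k + b2) (al k - (s + al b2)). *)
Lemma weighted_margin (R : realFieldType) (al b1 b2 c1 k : R) :
  `|b2| < k -> `|b1 * c1 + al * b2| < al * k ->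
  `|b1 * k * c1| < al * (k ^+ 2 - b2 ^+ 2) - c1 * b1 * b2.
Proof.
rewrite !ltr_norml => /andP[k1 k2] /andP[h1 h2].
have kD : 0 < k + b2 by rewrite -ltrBlDl sub0r.
have kB : 0 < k - b2 by rewrite subr_gt0.
have hD : 0 < al * k + (b1 * c1 + al * b2) by rewrite -ltrBlDl sub0r.
have hB : 0 < al * k - (b1 * c1 + al * b2) by rewrite subr_gt0.
apply/andP; split.
- by have := mulr_gt0 kB hD; lra.
- by have := mulr_gt0 kD hB; lra.
Qed.

(** * Three-dimensional cascade with delayed feedback *)

Local Notation o0 := (@Ordinal 3 0 isT).
Local Notation o1 := (@Ordinal 3 1 isT).
Local Notation o2 := (@Ordinal 3 2 isT).

Lemma big_ord3 (V : nmodType) (F : 'I_3 -> V) :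
  \sum_i F i = F o0 + F o1 + F o2.
Proof.
by rewrite !big_ord_recr big_ord0 /= add0r; congr (F _ + F _ + F _); apply: val_inj.
Qed.

Definition cascade_mx (R : realType) (a1 a2 a3 c1 c2 : R) : 'M[R]_3 :=
  mx_of_rows 3 3 [:: [:: a1;  0;  0]; [:: c1; a2;  0]; [::  0; c2; a3]].

Definition feedback_mx (R : realType) (b1 b2 : R) : 'M[R]_3 :=
  mx_of_rows 3 3 [:: [::  0;  0; b1]; [::  0;  0; b2]; [::  0;  0;  0]].

(** Each sign condition on a principal minor of N = A + s B comes from a single
    test vector: the first column y of the adjugate of a principal submatrix
    satisfies N y = det * e_1 there, so that the form y^T P N y is p_1 * det * y_1,
    where y_1 is the next smaller minor, whose sign is already known. *)
Lemma cascade_stable_necessary (R : realType) (a1 a2 a3 b1 b2 c1 c2 : R) :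
  diag_Riccati_stable (cascade_mx a1 a2 a3 c1 c2) (feedback_mx b1 b2) ->
  [/\ [/\ a1 < 0, a2 < 0 & a3 < 0],
      `|b2 * c2| < a2 * a3 &
      `|c2 * (b1 * c1 - a1 * b2)| < `|a1 * a2 * a3| ].
Proof.
move=> /diag_Riccati_stableP[p [q [p_gt0 q_gt0 neg]]].
have test s u v w : s ^+ 2 = 1 -> [|| u != 0, v != 0 | w != 0] ->
    p 0 o0 * u * (a1 * u + s * b1 * w)
    + p 0 o1 * v * (c1 * u + a2 * v + s * b2 * w)
    + p 0 o2 * w * (c2 * v + a3 * w) < 0.
  move=> s2 uvw; pose x : 'cV[R]_3 := \col_i nth 0 [:: u; v; w] i.
  have x0 : x != 0.
    apply: contraTneq uvw => x0; rewrite !negb_or !negbK.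
    by move/matrixP: x0 => x0; have := (x0 o0 0, x0 o1 0, x0 o2 0);
       rewrite !mxE /= => -[[-> ->] ->]; rewrite eqxx.
  have := le_lt_trans (riccati_form_ge (cascade_mx a1 a2 a3 c1 c2)
    (feedback_mx b1 b2) p x q_gt0 s2) (neg x x0).
  rewrite !big_ord3 !mxE !big_ord3 !mxE /= pmulrn_llt0 //.
  by congr (_ < _); ring.
have m11 : 1 ^+ 2 = 1 :> R by rewrite expr1n.
have mN1 : (-1) ^+ 2 = 1 :> R by rewrite sqrrN expr1n.
have [p1 p2 p3] := And3 (p_gt0 o0) (p_gt0 o1) (p_gt0 o2).
have a1_lt0 : a1 < 0.
  have := test 1 1 0 0 m11; rewrite oner_eq0 => /(_ isT).
  by rewrite -(pmulr_rlt0 a1 p1); congr (_ < _); ring.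
have a2_lt0 : a2 < 0.
  have := test 1 0 1 0 m11; rewrite oner_eq0 orbT => /(_ isT).
  by rewrite -(pmulr_rlt0 a2 p2); congr (_ < _); ring.
have a3_lt0 : a3 < 0.
  have := test 1 0 0 1 m11; rewrite oner_eq0 !orbT => /(_ isT).
  by rewrite -(pmulr_rlt0 a3 p3); congr (_ < _); ring.
have minor s : s ^+ 2 = 1 -> 0 < a2 * a3 - s * b2 * c2.
  move=> s2; have := test s 0 a3 (- c2) s2; rewrite (ltr0_neq0 a3_lt0) orbT => /(_ isT).
  rewrite -(nmulr_rlt0 (_ - _) a3_lt0) -(pmulr_rlt0 (a3 * _) p2).
  by congr (_ < _); ring.
(* here N y = (det, 0, 0) for the vector y whose first entry is the minor above *)
have det s : s ^+ 2 = 1 -> a1 * a2 * a3 + s * (c2 * (b1 * c1 - a1 * b2)) < 0.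
  move=> s2; have m0 := minor s s2.
  have := test s (a2 * a3 - s * b2 * c2) (- (c1 * a3)) (c1 * c2) s2.
  rewrite (lt0r_neq0 m0) => /(_ isT).
  rewrite -(pmulr_rlt0 (_ + s * _) m0) -(pmulr_rlt0 ((_ - _) * (_ + _)) p1).
  by congr (_ < _); ring.
have := (minor 1 m11, minor (-1) mN1, det 1 m11, det (-1) mN1) => -[[[h1 h2] h3] h4].
split=> //; rewrite ltr_norml; first by apply/andP; split; lra.
rewrite ltr0_norm; first by apply/andP; split; lra.
by rewrite -mulrA nmulr_rlt0 // nmulr_rgt0.
Qed.

Lemma cascade_stable_sufficient (R : realType) (a1 a2 a3 b1 b2 c1 c2 : R) :
  a1 < 0 -> a2 < 0 -> a3 < 0 -> `|b2 * c2| < a2 * a3 ->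
  `|c2 * (b1 * c1 - a1 * b2)| < `|a1 * a2 * a3| ->
  diag_Riccati_stable (cascade_mx a1 a2 a3 c1 c2) (feedback_mx b1 b2).
Proof.
move=> a1_lt0 a2_lt0 a3_lt0 bc_lt det_lt; apply/diag_Riccati_stableP.
have g_gt0 : 0 < a2 * a3 by rewrite nmulr_rgt0.
have t_lt : `|c2 * ((b1 * c1 - a1 * b2) / - a1)| < a2 * a3.
  rewrite mulrA normrM normfV normrN ltr_pdivrMr ?normr_gt0 ?ltr0_neq0 //.
  by rewrite -[a2 * a3](gtr0_norm g_gt0) -normrM [_ * a1]mulrC mulrA.
have [k [k_gt0 kc_le b_lt t_ltk]] := exists_gain_bound bc_lt t_lt.
have {t_ltk} beta_lt : `|b1 * c1 + - a1 * b2| < - a1 * k.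
  move: t_ltk; rewrite mulNr normrM normfV ltr_pdivrMr ?normrN ?normr_gt0 ?ltr0_neq0 //.
  by rewrite (ltr0_norm a1_lt0) [k * _]mulrC.
have [x x_gt0 xP] := exists_pos_scale (weighted_margin b_lt beta_lt).
have k2_gt : 0 < k ^+ 2 - b2 ^+ 2.
  rewrite subr_gt0 -[b2 ^+ 2]ger0_norm ?sqr_ge0 // normrX.
  by rewrite ltr_pXn2r ?nnegrE ?normr_ge0 ?ltW.
have disc0 : (c1 * x + b1 * b2) ^+ 2 < ((- a1 * x) *+ 2 - b1 ^+ 2) * (k ^+ 2 - b2 ^+ 2).
  rewrite -subr_gt0; move: xP; rewrite -subr_gt0; congr (_ < _); ring.
have N1_gt0 : 0 < (- a1 * x) *+ 2 - b1 ^+ 2.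
  by rewrite -(pmulr_lgt0 _ k2_gt) (le_lt_trans (sqr_ge0 _) disc0).
pose p1 := x^-1; pose p2 := - a2 / k ^+ 2; pose p3 := - a3^-1; pose g := c2 / a3.
have p1_gt0 : 0 < p1 by rewrite invr_gt0.
have p2_gt0 : 0 < p2 by rewrite divr_gt0 ?oppr_gt0 ?exprn_gt0.
have p3_gt0 : 0 < p3 by rewrite oppr_gt0 invr_lt0.
(* The form in u and v left after splitting off - (w + g v)^2, for
   q1 = q2 = 0, is - n1 u^2 + 2 m u v - n2 v^2. *)
pose n1 := (- a1 * p1) *+ 2 - (p1 * b1) ^+ 2.
pose n2 := (- a2 * p2) *+ 2 - (p2 * b2) ^+ 2 - g ^+ 2.
pose m := c1 * p2 + p1 * p2 * b1 * b2.
have n1E : n1 = p1 ^+ 2 * ((- a1 * x) *+ 2 - b1 ^+ 2).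
  rewrite /n1 /p1; field; exact: lt0r_neq0.
have n2_ge : p2 ^+ 2 * (k ^+ 2 - b2 ^+ 2) <= n2.
  have g_le : g ^+ 2 <= (p2 * k) ^+ 2.
    rewrite -[g ^+ 2]ger0_norm ?sqr_ge0 // normrX ler_pXn2r ?nnegrE ?normr_ge0 //; last first.
      by rewrite mulr_ge0 // ltW.
    have -> : p2 * k = - a2 / k by rewrite /p2; field; exact: lt0r_neq0.
    rewrite ler_pdivlMr // -[k in _ * k](gtr0_norm k_gt0) -normrM /g mulrAC normrM normfV.
    by rewrite ler_pdivrMr ?normr_gt0 ?ltr0_neq0 // (ltr0_norm a3_lt0) mulrNN mulrC.
  have -> : n2 = p2 ^+ 2 * (k ^+ 2 - b2 ^+ 2) + ((p2 * k) ^+ 2 - g ^+ 2).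
    rewrite /n2 /p2; field; exact: lt0r_neq0.
  by rewrite lerDl subr_ge0.
have n1_gt0 : 0 < n1 by rewrite n1E mulr_gt0 ?exprn_gt0.
have disc : m ^+ 2 < n1 * n2.
  apply: lt_le_trans (ler_wpM2l (ltW n1_gt0) n2_ge).
  have -> : m ^+ 2 = (p1 * p2) ^+ 2 * (c1 * x + b1 * b2) ^+ 2.
    rewrite /m /p1; field; exact: lt0r_neq0.
  by rewrite n1E [ltRHS]mulrACA -[p1 ^+ 2 * _]exprMn ltr_pM2l // exprn_gt0 // mulr_gt0.
have [e e_gt0 [e_lt disc_e]] := exists_shift_disc n1_gt0 disc.
exists (\row_i nth 0 [:: p1; p2; p3] i), (\row_i nth 0 [:: e; e; 1] i).
have forall3 (a b c : R) : 0 < a -> 0 < b -> 0 < c ->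
    forall i : 'I_3, 0 < (\row_i nth 0 [:: a; b; c] i : 'rV[R]_3) 0 i.
  by move=> ha hb hc [[|[|[|//]]] ?]; rewrite mxE.
split; [exact: forall3 | exact: forall3 | move=> y y0].
set u := y o0 0; set v := y o1 0; set w := y o2 0.
have -> : riccati_form (cascade_mx a1 a2 a3 c1 c2) (feedback_mx b1 b2)
     (\row_i nth 0 [:: p1; p2; p3] i) (\row_i nth 0 [:: e; e; 1] i) y
   = - (n1 - e) * u ^+ 2 + (m * u * v) *+ 2 - (n2 - e) * v ^+ 2 - (w + g * v) ^+ 2.
  rewrite /riccati_form !big_ord3 !mxE !big_ord3 !mxE /= -/u -/v -/w.
  rewrite /n1 /n2 /m /g /p3; field.
  by rewrite ltr0_neq0 // lt0r_neq0.
have [uv|] := boolP ((u != 0) || (v != 0)).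
  by rewrite ltr_wnDr ?oppr_le0 ?sqr_ge0 // neg_quad2 // subr_gt0.
rewrite negb_or !negbK => /andP[/eqP u0 /eqP v0].
have w0 : w != 0.
  apply: contra_neq y0 => w0; apply/matrixP => i j; rewrite ord1 mxE.
  case: i => [[|[|[|//]]] ?]; [rewrite -u0 | rewrite -v0 | rewrite -w0];
    by congr (y _ 0); apply: val_inj.
rewrite u0 v0 !expr0n /= !mulr0 mul0rn subr0 !addr0 add0r oppr_lt0.
by rewrite exprn_even_gt0.
Qed.

Theorem theorem4p1 (R : realType) (a1 a2 a3 b1 b2 c1 c2 : R) :
  let A : 'M[R]_3 := mx_of_rows 3 3 [:: [:: a1;  0;  0];
                                        [:: c1; a2;  0];
                                        [::  0; c2; a3]] in
  let B : 'M[R]_3 := mx_of_rows 3 3 [:: [::  0;  0; b1];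
                                        [::  0;  0; b2];
                                        [::  0;  0;  0]] in
  diag_Riccati_stable A B <->
  [/\ [/\ a1 < 0, a2 < 0 & a3 < 0],
      `|b2 * c2| < a2 * a3 &
      `|c2 * (b1 * c1 - a1 * b2)| < `|a1 * a2 * a3| ].
Proof.
by move=> A B; split=> [|[[? ? ?] ? ?]]; [exact: cascade_stable_necessary |
  exact: cascade_stable_sufficient].
Qed.
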